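(* Let $A=A^T\in\mathbb R^{n\times n}$, $k\ge1$, let $r_1,\dots,r_k$ be positive integers, $m=\sum_ir_i$, $0\le s\le r_k$, let $T=T^T\in\mathbb R^{m\times m}$ be block tridiagonal with respect to the partition $(r_1,\dots,r_k)$, and let $V=[V_1\ \cdots\ V_k]\in\mathbb R^{n\times m}$, $W\in\mathbb R^{n\times s}$, $H\in\mathbb R^{s\times r_k}$, $F\in\mathbb R^{n\times m}$ satisfy $V_i^TV_i=I_{r_i}$, $W^TW=I_s$, and $$AV=VT+WHE_k^T+F .$$ Let $(\theta_i,s_i)$, $i=1,\ldots,m$, be the eigenpairs of $T$ with orthonormal eigenvectors, and define $$y_i=Vs_i\in\mathbb R^n,\qquad w_i=HE_k^Ts_i\in\mathbb R^s,\qquad g_i=W^Ty_i\in\mathbb R^s .$$ The full physical residual is $Ay_i-\theta_iy_i=Ww_i+Fs_i$. For every $i$, $$g_i^Tw_i=-s_i^TMs_i,\qquad\text{so that}\qquad |g_i^Tw_i|\le\|M\|_2\le\mu,$$ and, for every $i\ne j$, $$(\theta_j-\theta_i)\,y_j^Ty_i=g_j^Tw_i-g_i^Tw_j+s_j^T\bigl(V^TF-F^TV\bigr)s_i .$$ Write $\rho_i=\|w_i\|_2$. Then $$\rho_i\,\bigl|\hat w_i^Tg_i\bigr|\le\mu\qquad(\hat w_i=w_i/\rho_i,\ \rho_i>0),$$ $$|y_j^Ty_i|\le\frac{\|g_j\|_2\rho_i+\|g_i\|_2\rho_j+e(\|y_i\|_2+\|y_j\|_2)}{|\theta_j-\thet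a_i|}\qquad(\theta_i\ne\theta_j).$$
   Context: $E_k\in\mathbb R^{m\times r_k}$ is the canonical injection into the last block. $U$ is the strictly block upper triangular matrix with blocks $U_{ij}=V_i^TV_j$ for $i<j$, so $V^TV=I+U+U^T$. $a=V^TW$ and $M=TU-UT-aHE_k^T\in\mathbb R^{m\times m}$, with diagonal blocks $M_{ii}$. $e=\|F\|_2$, $\zeta=\max_{1\le i\le k}\|M_{ii}\|_2$, and $\mu=k\max\{2e,\zeta\}$. $\|\cdot\|_2$ is the Euclidean/spectral norm. For $s=0$ the empty-matrix convention applies. (The letter $s$ without index is the width of $W$; $s_i$ with an index is an eigenvector.) *)

(* Defs.v *)
From mathcomp Require Export all_boot all_order all_algebra.
From mathcomp Require Export classical_sets reals.

Set Implicit Arguments.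
Unset Strict Implicit.
Unset Printing Implicit Defensive.

Import Order.TTheory GRing.Theory Num.Theory.

Local Open Scope classical_set_scope.
Local Open Scope ring_scope.

Definition dotv (R : realType) (n : nat) (u v : 'cV[R]_n) : R := (u^T *m v) 0 0.

Definition norm2 (R : realType) (n : nat) (u : 'cV[R]_n) : R := Num.sqrt (dotv u u).

(* The supremum is over a nonempty bounded set for all dimensions p and q;
   if p or q is 0 the set is {0} and the norm is 0. *)
Definition specnorm (R : realType) (p q : nat) (A : 'M[R]_(p, q)) : R :=
  sup [set norm2 (A *m x) | x in [set x : 'cV[R]_q | norm2 x <= 1]].

Definition last_block (k : nat) (hk : (0 < k)%N) : 'I_k :=
  Ordinal (etrans (ltn_predL k) hk).

(* E_k is the last block column of the identity, so that E_k^T x is the last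
   block of x. *)
Definition inj_last (R : realType) (k : nat) (hk : (0 < k)%N) (r : 'I_k -> nat) :
    'M[R]_(\sum_(i < k) r i, r (last_block hk)) :=
  submxrow 1%:M (last_block hk).

Definition block_tridiagonal (R : realType) (k : nat) (r : 'I_k -> nat)
    (T : 'M[R]_(\sum_(i < k) r i)) : Prop :=
  forall i j : 'I_k, (i.+1 < j)%N || (j.+1 < i)%N -> submxblock T i j = 0.

(* The strictly block upper triangular part U of V^T V. *)
Definition gram_upper (R : realType) (n k : nat) (r : 'I_k -> nat)
    (V : 'M[R]_(n, \sum_(i < k) r i)) : 'M[R]_(\sum_(i < k) r i) :=
  \mxblock_(i < k, j < k)
    (if (i < j)%N then (submxrow V i)^T *m submxrow V j else 0).

(* Main.v *)
(* With G = V^T V = I + U + U^T and C = a H E_k^T, symmetry of A turns the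
   recurrence into TG - GT = C - C^T + (V^T F - F^T V).  Evaluated on
   eigenvectors of T this is the identity for y_j^T y_i.  It also says
   M - M^T = V^T F - F^T V.  Since T is block tridiagonal and U is strictly
   block upper triangular, M is block upper triangular, so each off-diagonal
   block of M is a block of V^T F - F^T V, of norm at most 2e; a matrix with
   k x k blocks of norm at most c has norm at most kc.  Finally
   g_i^T w_i = s_i^T C s_i, and s_i^T (TU - UT) s_i = 0. *)

Require Import Defs.
From mathcomp Require Import all_boot all_order all_algebra.
From mathcomp Require Import classical_sets reals.
From mathcomp Require Import ring.

Set Implicit Arguments.
Unset Strict Implicit.
Unset Printing Implicit Defensive.

Import Order.TTheory GRing.Theory Num.Theory.

Local Open Scope ring_scope.

(** * Euclidean inner product and norm *)

Lemma dotvE (R : realType) n (u v : 'cV[R]_n) :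
  dotv u v = \sum_i u i 0 * v i 0.
Proof. by rewrite /dotv mxE; apply: eq_bigr => i _; rewrite mxE. Qed.

Lemma dotvC (R : realType) n (u v : 'cV[R]_n) : dotv u v = dotv v u.
Proof. by rewrite !dotvE; apply: eq_bigr => i _; rewrite mulrC. Qed.

Lemma dotvDr (R : realType) n (u v w : 'cV[R]_n) :
  dotv u (v + w) = dotv u v + dotv u w.
Proof. by rewrite /dotv mulmxDr mxE. Qed.

Lemma dotv0r (R : realType) n (u : 'cV[R]_n) : dotv u 0 = 0.
Proof. by rewrite /dotv mulmx0 mxE. Qed.

Lemma dotvNr (R : realType) n (u v : 'cV[R]_n) : dotv u (- v) = - dotv u v.
Proof. by rewrite /dotv mulmxN mxE. Qed.

Lemma dotvBr (R : realType) n (u v w : 'cV[R]_n) :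
  dotv u (v - w) = dotv u v - dotv u w.
Proof. by rewrite dotvDr dotvNr. Qed.

Lemma dotvZr (R : realType) n (u v : 'cV[R]_n) a :
  dotv u (a *: v) = a * dotv u v.
Proof. by rewrite /dotv -scalemxAr mxE. Qed.

Lemma dotvZl (R : realType) n (u v : 'cV[R]_n) a :
  dotv (a *: u) v = a * dotv u v.
Proof. by rewrite dotvC dotvZr dotvC. Qed.

Lemma dotv_mulr (R : realType) p q (A : 'M[R]_(p, q)) u v :
  dotv u (A *m v) = dotv (A^T *m u) v.
Proof. by rewrite /dotv trmx_mul trmxK mulmxA. Qed.

Lemma dotv_ge0 (R : realType) n (u : 'cV[R]_n) : 0 <= dotv u u.
Proof. by rewrite dotvE; apply: sumr_ge0 => i _; rewrite -expr2 sqr_ge0. Qed.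

Lemma norm2_ge0 (R : realType) n (u : 'cV[R]_n) : 0 <= norm2 u.
Proof. exact: sqrtr_ge0. Qed.
#[local] Hint Extern 0 (is_true (0 <= norm2 _)) => exact: norm2_ge0 : core.

Lemma sqr_norm2 (R : realType) n (u : 'cV[R]_n) : norm2 u ^+ 2 = dotv u u.
Proof. by rewrite sqr_sqrtr ?dotv_ge0. Qed.

Lemma norm20 (R : realType) n : norm2 (0 : 'cV[R]_n) = 0.
Proof. by rewrite /norm2 dotv0r sqrtr0. Qed.

Lemma norm2_eq0 (R : realType) n (u : 'cV[R]_n) : norm2 u = 0 -> u = 0.
Proof.
move=> nu0; have := sqr_norm2 u; rewrite nu0 expr0n dotvE /= => /esym.
move=> /psumr_eq0P u0; apply/colP => i; rewrite mxE.
by apply/eqP; rewrite -[_ == 0]orbb -mulf_eq0 u0 // => j _;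
   rewrite -expr2 sqr_ge0.
Qed.

Lemma norm2Z (R : realType) n a (u : 'cV[R]_n) :
  norm2 (a *: u) = `|a| * norm2 u.
Proof.
by rewrite /norm2 dotvZl dotvZr mulrA -expr2 sqrtrM ?sqr_ge0 // sqrtr_sqr.
Qed.

Lemma dotv_CauchySchwarz (R : realType) n (u v : 'cV[R]_n) :
  `|dotv u v| <= norm2 u * norm2 v.
Proof.
have [v0|vN0] := eqVneq (norm2 v) 0.
  by rewrite v0 (norm2_eq0 v0) dotv0r normr0 mulr0.
have vv : 0 < dotv v v.
  by rewrite -sqr_norm2; apply: exprn_gt0;
     rewrite lt_neqAle eq_sym vN0 norm2_ge0.
rewrite -ler_sqr ?nnegrE ?mulr_ge0 // real_normK ?num_real //.
rewrite exprMn !sqr_norm2 -subr_ge0 -(pmulr_rge0 _ vv).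
(* This squared norm expands to [v.v * (u.u * v.v - (u.v)^2)], the goal after multiplication by
   [v.v > 0], so no division occurs. *)
have := dotv_ge0 (dotv v v *: u - dotv u v *: v).
rewrite dotvBr !dotvZr ![dotv (_ - _) _]dotvC !dotvBr !dotvZr (dotvC v u).
move: (dotv u u) (dotv u v) (dotv v v) => x y z /=; congr (0 <= _); ring.
Qed.

(** * Spectral norm *)

(** The Frobenius norm is an upper bound, by Cauchy-Schwarz on each row. Boundedness is what makes
    the supremum in [specnorm] dominate its set. *)
Lemma norm2_mulmx_bounded (R : realType) p q (A : 'M[R]_(p, q)) :
  has_ubound [set norm2 (A *m x) | x in [set x : 'cV[R]_q | norm2 x <= 1]].
Proof.
exists (Num.sqrt (\sum_i norm2 (row i A)^T ^+ 2)) => _ [x /= x1 <-].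
apply: ler_wsqrtr; rewrite dotvE; apply: ler_sum => i _.
rewrite -expr2 -[_ ^+ 2]real_normK ?num_real // ler_sqr ?nnegrE //.
have -> : (A *m x) i 0 = dotv (row i A)^T x.
  by rewrite mxE dotvE; apply: eq_bigr => j _; rewrite !mxE.
by apply: le_trans (dotv_CauchySchwarz _ _) _; rewrite ler_piMr.
Qed.

Lemma specnorm_ge0 (R : realType) p q (A : 'M[R]_(p, q)) : 0 <= specnorm A.
Proof.
apply: (ub_le_sup (norm2_mulmx_bounded A)); exists 0;
  by rewrite /= ?mulmx0 norm20.
Qed.

Lemma norm2_mulmx (R : realType) p q (A : 'M[R]_(p, q)) x :
  norm2 (A *m x) <= specnorm A * norm2 x.
Proof.
have [x0|xN0] := eqVneq (norm2 x) 0.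
  by rewrite (norm2_eq0 x0) mulmx0 !norm20 mulr0.
have xgt0 : 0 < norm2 x by rewrite lt_neqAle eq_sym xN0 norm2_ge0.
rewrite -ler_pdivrMr // mulrC -[_^-1]ger0_norm ?invr_ge0 // -norm2Z.
rewrite scalemxAr; apply: (ub_le_sup (norm2_mulmx_bounded A)).
by exists ((norm2 x)^-1 *: x); rewrite //= norm2Z ger0_norm ?invr_ge0 // mulVf.
Qed.

Lemma dotv_mulmx_le (R : realType) p q (A : 'M[R]_(p, q)) u x :
  `|dotv u (A *m x)| <= specnorm A * (norm2 u * norm2 x).
Proof.
apply: le_trans (dotv_CauchySchwarz _ _) _.
by rewrite mulrCA ler_wpM2l // norm2_mulmx.
Qed.

(** Testing the bilinear form with [u = A x] gives [|Ax|^2 <= c |Ax| |x|], and a nonzero factor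
    [|Ax|] cancels. *)
Lemma specnorm_le (R : realType) p q (A : 'M[R]_(p, q)) c : 0 <= c ->
  (forall u x, `|dotv u (A *m x)| <= c * (norm2 u * norm2 x)) ->
  specnorm A <= c.
Proof.
move=> c0 Ac; apply: ge_sup.
  by exists (norm2 (A *m 0)); exists 0; rewrite //= norm20.
move=> _ [x /= x1 <-].
have [->//|AxN0] := eqVneq (norm2 (A *m x)) 0.
have Axgt0 : 0 < norm2 (A *m x) by rewrite lt_neqAle eq_sym AxN0 norm2_ge0.
rewrite -(ler_pM2r Axgt0) -expr2 sqr_norm2.
apply: le_trans (ler_norm _) _; apply: le_trans (Ac _ _) _.
by rewrite ler_wpM2l // ler_piMr.
Qed.

(** * Block calculus *)

Lemma dotv_submxcol (R : realType) k (r : 'I_k -> nat)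
    (u v : 'cV[R]_(\sum_i r i)) :
  dotv u v = \sum_i dotv (submxcol u i) (submxcol v i).
Proof.
rewrite /dotv -{1}(submxcolK u) -{1}(submxcolK v) tr_mxcol mul_mxrow_mxcol.
by rewrite summxE.
Qed.

Lemma submxblock_mul (R : pzSemiRingType) p q s (p_ : 'I_p -> nat)
    (q_ : 'I_q -> nat) (s_ : 'I_s -> nat)
    (A : 'M[R]_(\sum_i p_ i, \sum_i q_ i))
    (B : 'M[R]_(\sum_i q_ i, \sum_i s_ i)) i j :
  submxblock (A *m B) i j = \sum_l submxblock A i l *m submxblock B l j.
Proof.
by rewrite -{1}(submxblockK A) -{1}(submxblockK B) mul_mxblock mxblockK.
Qed.

Lemma submxcol_mulmx (R : pzSemiRingType) p q (p_ : 'I_p -> nat)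
    (q_ : 'I_q -> nat) n (A : 'M[R]_(\sum_i p_ i, \sum_i q_ i))
    (x : 'M[R]_(\sum_i q_ i, n)) i :
  submxcol (A *m x) i = \sum_j submxblock A i j *m submxcol x j.
Proof.
by rewrite -{1}(submxblockK A) -{1}(submxcolK x) mul_mxblock_mxrow mxcolK.
Qed.

Lemma submxblock_mulmx (R : pzSemiRingType) p q (p_ : 'I_p -> nat)
    (q_ : 'I_q -> nat) n (A : 'M[R]_(\sum_i p_ i, n))
    (B : 'M[R]_(n, \sum_i q_ i)) i j :
  submxblock (A *m B) i j = submxcol A i *m submxrow B j.
Proof. by rewrite submxblockEh -mul_submxrow -submxcol_mul. Qed.

Lemma submxblock1 (R : pzRingType) k (r : 'I_k -> nat) (i : 'I_k) :
  submxblock (1%:M : 'M[R]_(\sum_i r i)) i i = 1%:M.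
Proof. by rewrite -mxdiagZ submxblock_diag. Qed.

Lemma submxblock1_neq (R : pzRingType) k (r : 'I_k -> nat) (i j : 'I_k) :
  i != j -> submxblock (1%:M : 'M[R]_(\sum_i r i)) i j = 0.
Proof. by move=> ij; rewrite -mxdiagZ mxblockK (negbTE ij). Qed.

(** * Norm of a matrix with uniformly bounded blocks *)

(** Cauchy-Schwarz against the all-ones vector, whose squared norm is [k]. *)
Lemma sqr_sum_le (R : realType) k (x : 'I_k -> R) :
  (\sum_i x i) ^+ 2 <= k%:R * \sum_i x i ^+ 2.
Proof.
have := dotv_CauchySchwarz (const_mx 1) (\col_i x i).
rewrite -ler_sqr ?nnegrE ?mulr_ge0 // real_normK ?num_real //.
rewrite exprMn !sqr_norm2 !dotvE.
under eq_bigr => i _ do rewrite !mxE mul1r.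
under [in X in _ <= X * _]eq_bigr => i _ do rewrite !mxE mul1r.
under [in X in _ <= _ * X]eq_bigr => i _ do rewrite !mxE -expr2.
by rewrite sumr_const card_ord.
Qed.

Lemma sum_norm2_submxcol_le (R : realType) k (r : 'I_k -> nat)
    (u : 'cV[R]_(\sum_i r i)) :
  \sum_i norm2 (submxcol u i) <= Num.sqrt k%:R * norm2 u.
Proof.
rewrite -ler_sqr ?nnegrE ?mulr_ge0 ?sqrtr_ge0 //; last exact: sumr_ge0.
apply: le_trans (sqr_sum_le _) _.
rewrite exprMn sqr_sqrtr ?ler0n // sqr_norm2 dotv_submxcol.
by under eq_bigr => i _ do rewrite sqr_norm2.
Qed.

(** The double sum of block bounds factors into the block-norm sums of [u] and of [x]; each
    contributes [sqrt k], hence the factor [k]. *)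
Lemma specnorm_block_le (R : realType) k (r : 'I_k -> nat)
    (A : 'M[R]_(\sum_(i < k) r i)) c : 0 <= c ->
  (forall i j u x,
    `|dotv u (submxblock A i j *m x)| <= c * (norm2 u * norm2 x)) ->
  specnorm A <= k%:R * c.
Proof.
move=> c0 Ac; apply: specnorm_le => [|u x]; first by rewrite mulr_ge0.
rewrite dotv_submxcol; apply: le_trans (ler_norm_sum _ _ _) _.
apply: (@le_trans _ _ (\sum_i \sum_j
    c * (norm2 (submxcol u i) * norm2 (submxcol x j)))).
  apply: ler_sum => i _; rewrite submxcol_mulmx.
  rewrite (big_morph _ (dotvDr _) (dotv0r _)).
  by apply: le_trans (ler_norm_sum _ _ _) _; apply: ler_sum.
under eq_bigr => i _ do rewrite -mulr_sumr -mulr_sumr.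
rewrite -mulr_sumr -mulr_suml [k%:R * c]mulrC -mulrA ler_wpM2l //.
have -> : k%:R * (norm2 u * norm2 x) =
    Num.sqrt k%:R * norm2 u * (Num.sqrt k%:R * norm2 x).
  by rewrite mulrACA -expr2 sqr_sqrtr ?ler0n.
by apply: ler_pM; rewrite ?sum_norm2_submxcol_le ?sumr_ge0.
Qed.

(** * Gram matrix and its commutator with [T] *)

Lemma gram_decomp (R : realType) n k (r : 'I_k -> nat)
    (V : 'M[R]_(n, \sum_(i < k) r i)) :
  (forall i, (submxrow V i)^T *m submxrow V i = 1%:M) ->
  V^T *m V = 1%:M + gram_upper V + (gram_upper V)^T.
Proof.
move=> hV; apply/mxblockP => i j; rewrite submxblock_mulmx -tr_submxrow.
rewrite !submxblockD -tr_submxblock /gram_upper !mxblockK.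
have [ij|ji|/val_inj ->] := ltngtP i j.
- by rewrite submxblock1_neq ?trmx0 ?addr0 ?add0r // neq_ltn ij.
- by rewrite submxblock1_neq ?add0r ?trmx_mul ?trmxK // neq_ltn ji orbT.
- by rewrite hV submxblock1 trmx0 !addr0.
Qed.

(** [V^T A V] is computed twice, applying the recurrence to [A V] and, by symmetry of [A], its
    transpose to [V^T A]; the two results are equated. *)
Lemma gram_commutator (R : realType) n m (A : 'M[R]_n) (T : 'M[R]_m)
    (V B F : 'M[R]_(n, m)) :
  A = A^T -> T = T^T -> A *m V = V *m T + B + F ->
  T *m (V^T *m V) - V^T *m V *m T =
    V^T *m B - (V^T *m B)^T + (V^T *m F - F^T *m V).
Proof.
move=> hA hT hAV.
have VAV : V^T *m (A *m V) = V^T *m V *m T + V^T *m B + V^T *m F.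
  by rewrite hAV !mulmxDr mulmxA.
have : V^T *m (A *m V) = T *m (V^T *m V) + (V^T *m B)^T + F^T *m V.
  rewrite mulmxA {1}hA -trmx_mul hAV !linearD /= !mulmxDl !trmx_mul trmxK -hT.
  by rewrite mulmxA.
rewrite VAV; move: (V^T *m V *m T) (T *m _) (V^T *m B) (V^T *m F) (F^T *m V).
move=> X Y Z P Q e; have -> : Y = X + Z + P - Q - Z^T.
  by rewrite e addrK addrK.
by apply/matrixP => i j; rewrite !mxE; ring.
Qed.

(** In the commutator of [T] with [I + U + U^T] the identity drops out, and the [U^T] part is minus
    the transpose of [TU - UT] because [T] is symmetric. *)
Lemma skew_part_coupling (R : realType) n k (r : 'I_k -> nat) (A : 'M[R]_n)
    (T : 'M[R]_(\sum_(i < k) r i)) (V B F : 'M[R]_(n, \sum_(i < k) r i)) :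
  A = A^T -> T = T^T -> A *m V = V *m T + B + F ->
  (forall i, (submxrow V i)^T *m submxrow V i = 1%:M) ->
  let M := T *m gram_upper V - gram_upper V *m T - V^T *m B in
  M - M^T = V^T *m F - F^T *m V.
Proof.
move=> hA hT hAV hV M; rewrite /M.
have := gram_commutator hA hT hAV.
rewrite (gram_decomp hV) !mulmxDr !mulmxDl mulmx1 mul1mx !linearB /=.
rewrite (trmx_mul T) (trmx_mul _ T) -hT.
move: (V^T *m F - _) (T *m gram_upper V) (gram_upper V *m T) (V^T *m B).
move: (T *m (gram_upper V)^T) ((gram_upper V)^T *m T) => P Q D X Y Z e.
have -> : D = T + X + P - (T + Y + Q) - (Z - Z^T) by rewrite e addrC addKr.
by apply/matrixP => i j; rewrite !mxE; ring.
Qed.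

(** * Block upper triangularity of [M] *)

Lemma submxblock_gram_upper_eq0 (R : realType) n k (r : 'I_k -> nat)
    (V : 'M[R]_(n, \sum_(i < k) r i)) (i j : 'I_k) :
  (j <= i)%N -> submxblock (gram_upper V) i j = 0.
Proof. by move=> ji; rewrite mxblockK ltnNge ji. Qed.

(** Strictness of [U] absorbs the subdiagonal of [T]: a nonzero [U_lj] needs [l < j < i], so [l] and
    [i] differ by at least two and [T_il = 0]. *)
Lemma block_tridiagonal_mul_gram_upper (R : realType) n k (r : 'I_k -> nat)
    (T : 'M[R]_(\sum_(i < k) r i)) (V : 'M[R]_(n, \sum_(i < k) r i))
    (i j : 'I_k) :
  block_tridiagonal T -> (j < i)%N -> submxblock (T *m gram_upper V) i j = 0.
Proof.
move=> hT ji; rewrite submxblock_mul big1 // => l _.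
have [lj|jl] := ltnP l j; last by rewrite submxblock_gram_upper_eq0 ?mulmx0.
by rewrite hT ?mul0mx // (leq_ltn_trans lj ji) orbT.
Qed.

Lemma gram_upper_mul_block_tridiagonal (R : realType) n k (r : 'I_k -> nat)
    (T : 'M[R]_(\sum_(i < k) r i)) (V : 'M[R]_(n, \sum_(i < k) r i))
    (i j : 'I_k) :
  block_tridiagonal T -> (j < i)%N -> submxblock (gram_upper V *m T) i j = 0.
Proof.
move=> hT ji; rewrite submxblock_mul big1 // => l _.
have [il|li] := ltnP i l; last by rewrite submxblock_gram_upper_eq0 ?mul0mx.
by rewrite hT ?mulmx0 // (leq_ltn_trans ji il) orbT.
Qed.

(** The bound [j < i] says that [j] is not the last index, so this is an off-diagonal block of the
    identity. *)
Lemma submxcol_inj_last (R : realType) k (hk : (0 < k)%N) (r : 'I_k -> nat)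
    (i j : 'I_k) :
  (j < i)%N -> submxcol (inj_last R hk r) j = 0.
Proof.
move=> ji; rewrite /inj_last -submxblockEh submxblock1_neq //.
by rewrite neq_ltn (leq_trans ji) // -ltnS /= prednK.
Qed.

Lemma coupling_upper (R : realType) n k (hk : (0 < k)%N) (r : 'I_k -> nat)
    (T : 'M[R]_(\sum_(i < k) r i)) (V : 'M[R]_(n, \sum_(i < k) r i))
    (C : 'M[R]_(\sum_(i < k) r i, r (last_block hk))) (i j : 'I_k) :
  block_tridiagonal T -> (j < i)%N ->
  submxblock (T *m gram_upper V - gram_upper V *m T
              - C *m (inj_last R hk r)^T) i j = 0.
Proof.
move=> hT ji; rewrite !submxblockB block_tridiagonal_mul_gram_upper //.
rewrite gram_upper_mul_block_tridiagonal // submxblock_mulmx -tr_submxcol.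
by rewrite (submxcol_inj_last R hk r ji) trmx0 mulmx0 !subr0.
Qed.

(** * Bound on the norm of [M] *)

Lemma norm2_isometry (R : realType) p q (A : 'M[R]_(p, q)) x :
  A^T *m A = 1%:M -> norm2 (A *m x) = norm2 x.
Proof. by move=> AA; rewrite /norm2 dotv_mulr mulmxA AA mul1mx. Qed.

(** [F_i] is [F] times a block column of the identity, which is an isometry. *)
Lemma norm2_submxrow_mulmx (R : realType) n k (r : 'I_k -> nat)
    (F : 'M[R]_(n, \sum_(i < k) r i)) i x :
  norm2 (submxrow F i *m x) <= specnorm F * norm2 x.
Proof.
rewrite -{1}[F]mulmx1 -mul_submxrow -mulmxA.
apply: le_trans (norm2_mulmx _ _) _; rewrite norm2_isometry //.
by rewrite tr_submxrow trmx1 -submxblock_mulmx mulmx1 submxblock1.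
Qed.

(* Strictly above the diagonal the transposed block vanishes, so there the
   block coincides with that of [M - M^T]. *)
Lemma specnorm_upper_le (R : realType) n k (r : 'I_k -> nat)
    (V F : 'M[R]_(n, \sum_(i < k) r i)) (M : 'M[R]_(\sum_(i < k) r i)) :
  (forall i, (submxrow V i)^T *m submxrow V i = 1%:M) ->
  (forall i j : 'I_k, (j < i)%N -> submxblock M i j = 0) ->
  M - M^T = V^T *m F - F^T *m V ->
  specnorm M <= k%:R * Num.max (2 * specnorm F)
    (\big[Num.max/0]_(i < k) specnorm (submxblock M i i)).
Proof.
move=> hV Mup Mskew; have F0 := specnorm_ge0 F.
set c := Num.max _ _.
have c0 : 0 <= c by rewrite le_max mulr_ge0.
apply: specnorm_block_le => // i j u x.
have ux0 : 0 <= norm2 u * norm2 x by rewrite mulr_ge0.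
have [ij|ji|/val_inj eq_ij] := ltngtP i j.
- have -> : submxblock M i j =
      (submxrow V i)^T *m submxrow F j - (submxrow F i)^T *m submxrow V j.
    rewrite !tr_submxrow -!submxblock_mulmx -submxblockB -Mskew submxblockB.
    by rewrite -tr_submxblock (Mup _ _ ij) trmx0 subr0.
  (* Moving the transposed factors across leaves [V_i u . F_j x] and [F_i u . V_j x]; as [V_i] and
     [V_j] are isometries, each costs one [specnorm F]. *)
  rewrite mulmxBl dotvBr -!mulmxA [dotv u ((submxrow V i)^T *m _)]dotv_mulr.
  rewrite [dotv u ((submxrow F i)^T *m _)]dotv_mulr !trmxK.
  apply: le_trans (ler_normB _ _) _.
  apply: (@le_trans _ _ (2 * specnorm F * (norm2 u * norm2 x))); last first.
    by apply: ler_wpM2r => //; rewrite le_max lexx.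
  rewrite -mulrA mulr_natl mulr2n; apply: lerD.
    apply: le_trans (dotv_CauchySchwarz _ _) _.
    by rewrite (norm2_isometry _ (hV i)) mulrCA ler_wpM2l ?norm2_submxrow_mulmx.
  apply: le_trans (dotv_CauchySchwarz _ _) _.
  by rewrite (norm2_isometry _ (hV j)) mulrA ler_wpM2r ?norm2_submxrow_mulmx.
- by rewrite Mup // mul0mx dotv0r normr0 mulr_ge0.
- subst j; apply: le_trans (dotv_mulmx_le _ _ _) _; apply: ler_wpM2r => //.
  by rewrite le_max (le_bigmax _ (fun i => specnorm (submxblock M i i)) i) orbT.
Qed.

(** * Residuals, couplings and inner products of the vectors [y_i] *)

Theorem theorem7 (R : realType) (n k s : nat) (hk : (0 < k)%N)
    (r : 'I_k -> nat) (hr : forall i, (0 < r i)%N)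
    (hs : (s <= r (last_block hk))%N)
    (A : 'M[R]_n) (hA : A = A^T)
    (T : 'M[R]_(\sum_(i < k) r i)) (hT : T = T^T)
    (hTtri : block_tridiagonal T)
    (V : 'M[R]_(n, \sum_(i < k) r i)) (W : 'M[R]_(n, s))
    (H : 'M[R]_(s, r (last_block hk))) (F : 'M[R]_(n, \sum_(i < k) r i))
    (hV : forall i, (submxrow V i)^T *m submxrow V i = 1%:M)
    (hW : W^T *m W = 1%:M)
    (hAV : A *m V = V *m T + W *m H *m (inj_last R hk r)^T + F)
    (theta : 'I_(\sum_(i < k) r i) -> R)
    (S : 'I_(\sum_(i < k) r i) -> 'cV[R]_(\sum_(i < k) r i))
    (heig : forall i, T *m S i = theta i *: S i)
    (horth : forall i j, dotv (S i) (S j) = (i == j)%:R) :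
  let E := inj_last R hk r in
  let U := gram_upper V in
  let a := V^T *m W in
  let M := T *m U - U *m T - a *m H *m E^T in
  let e := specnorm F in
  let zeta := \big[Num.max/0]_(i < k) specnorm (submxblock M i i) in
  let mu := k%:R * Num.max (2 * e) zeta in
  let y := fun i => V *m S i in
  let w := fun i => H *m E^T *m S i in
  let g := fun i => W^T *m y i in
  let rho := fun i => norm2 (w i) in
  let w_hat := fun i => (rho i)^-1 *: w i in
  (forall i, A *m y i - theta i *: y i = W *m w i + F *m S i) /\
  (forall i, dotv (g i) (w i) = - dotv (S i) (M *m S i)) /\
  (forall i, `|dotv (g i) (w i)| <= specnorm M) /\
  specnorm M <= mu /\
  (forall i j, i != j ->
     (theta j - theta i) * dotv (y j) (y i) =
       dotv (g j) (w i) - dotv (g i) (w j)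
       + dotv (S j) ((V^T *m F - F^T *m V) *m S i)) /\
  (forall i, 0 < rho i -> rho i * `|dotv (w_hat i) (g i)| <= mu) /\
  (forall i j, theta i != theta j ->
     `|dotv (y j) (y i)| <=
       (norm2 (g j) * rho i + norm2 (g i) * rho j
        + e * (norm2 (y i) + norm2 (y j))) / `|theta j - theta i|).
Proof.
move=> E U a M e zeta mu y w g rho w_hat.
pose B := W *m H *m E^T.
have aB : a *m H *m E^T = V^T *m B by rewrite /a /B !mulmxA.
have skew : M - M^T = V^T *m F - F^T *m V.
  by rewrite /M aB; exact: (skew_part_coupling hA hT hAV hV).
have hmu : specnorm M <= mu.
  apply: specnorm_upper_le skew => // i j ji.
  exact: coupling_upper.
have Sunit i : norm2 (S i) = 1 by rewrite /norm2 horth eqxx sqrtr1.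
have gw i j : dotv (g j) (w i) = dotv (S j) (V^T *m B *m S i).
  by rewrite /g /w /y /B -!mulmxA [RHS]dotv_mulr trmxK [RHS]dotv_mulr.
have Teig i x : dotv (S i) (T *m x) = theta i * dotv (S i) x.
  by rewrite dotv_mulr -hT heig dotvZl.
have gM i : dotv (g i) (w i) = - dotv (S i) (M *m S i).
  rewrite gw /M aB !mulmxBl !dotvBr.
  (* Both halves of the commutator become [theta_i * S_i . U S_i] and cancel. *)
  rewrite -[T *m U *m _]mulmxA -[U *m T *m _]mulmxA Teig heig.
  by rewrite -scalemxAr dotvZr subrr sub0r opprK.
have gnorm i : `|dotv (g i) (w i)| <= specnorm M.
  rewrite gM normrN; apply: le_trans (dotv_mulmx_le _ _ _) _.
  by rewrite !Sunit !mulr1.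
have ident i j : (theta j - theta i) * dotv (y j) (y i) =
    dotv (g j) (w i) - dotv (g i) (w j)
    + dotv (S j) ((V^T *m F - F^T *m V) *m S i).
  have -> : dotv (g i) (w j) = dotv (S j) ((V^T *m B)^T *m S i).
    by rewrite gw [RHS]dotv_mulr trmxK dotvC.
  rewrite gw -dotvBr -dotvDr -mulmxBl -mulmxDl.
  rewrite -(gram_commutator hA hT hAV) mulmxBl dotvBr -!mulmxA Teig heig.
  by rewrite -!scalemxAr dotvZr /y -mulrBl [in RHS]dotv_mulr trmxK.
split.
  move=> i; rewrite /y mulmxA hAV !mulmxDl -[V *m T *m _]mulmxA heig -scalemxAr.
  by rewrite addrC !addrA addNr add0r /w !mulmxA.
do 5![split=> //].
  (* The factor [rho_i] cancels the normalization of [w_hat], leaving [|g_i . w_i|]. *)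
  move=> i rho0; rewrite /w_hat dotvZl normrM gtr0_norm ?invr_gt0 //.
  by rewrite mulVKf ?gt_eqF // dotvC (le_trans (gnorm i)).
move=> i j ij; have ij0 : 0 < `|theta j - theta i|.
  by rewrite normr_gt0 subr_eq0 eq_sym.
rewrite ler_pdivlMr // mulrC -normrM ident.
apply: le_trans (ler_normD _ _) _; apply: lerD.
  apply: le_trans (ler_normB _ _) _.
  by apply: lerD; exact: dotv_CauchySchwarz.
(* The perturbation term is [y_j . F S_i - F S_j . y_i], and [|F S_i| <= e] for unit [S_i]. *)
rewrite mulmxBl dotvBr -!mulmxA dotv_mulr trmxK [dotv _ (F^T *m _)]dotv_mulr.
rewrite trmxK; apply: le_trans (ler_normB _ _) _.
rewrite addrC mulrDr; apply: lerD; rewrite -/(y _).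
  apply: le_trans (dotv_CauchySchwarz _ _) _; apply: ler_wpM2r => //.
  by apply: le_trans (norm2_mulmx _ _) _; rewrite Sunit mulr1.
apply: le_trans (dotv_CauchySchwarz _ _) _; rewrite mulrC.
apply: ler_wpM2r => //.
by apply: le_trans (norm2_mulmx _ _) _; rewrite Sunit mulr1.
Qed.
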